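(* Let $\ell^{OI}$ be a line in a Desargues affine plane, with its skew field structure $(\ell^{OI},+,\cdot)$ given by addition and multiplication of points. Let $A,B,D\in\ell^{OI}$ be three fixed, pairwise different points, each different from $O$. For $X\in\ell^{OI}$ put $f_C(X)=c_r(A,B;X,D)=[(A-D)^{-1}(B-D)][(B-X)^{-1}(A-X)]$ and let $\mathcal{R}^{C}_4=\{f_C(X)\mid X\in\ell^{OI}\}$. Then the elements $f_C(\cdot)$ of $\mathcal{R}^{C}_4$, with addition of points, satisfy: (1) associativity: $[f_C(X)+f_C(Y)]+f_C(Z)=f_C(X)+[f_C(Y)+f_C(Z)]$ for all $X,Y,Z\in\ell^{OI}$; (2) commutativity: $f_C(X)+f_C(Y)=f_C(Y)+f_C(X)$ for all $X,Y\in\ell^{OI}$; (3) existence of a neutral (zero) element: there is $Z\in\ell^{OI}$ such that $f_C(X)+f_C(Z)=f_C(X)$ for all $X\in\ell^{OI}$.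
   Context: A Desargues affine plane is an affine plane (two distinct points lie on exactly one line; through a point $P$ not on a line $\ell$ passes exactly one line disjoint from $\ell$; there are three non-collinear points) satisfying Desargues' axiom: if $\ell^{AA'},\ell^{BB'},\ell^{CC'},\ell^{AC},\ell^{A'C'}$ are pairwise distinct lines such that $\ell^{AA'},\ell^{BB'},\ell^{CC'}$ are all parallel or all meet in one point $P$, and if $\ell^{AB}\parallel\ell^{A'B'}$, $\ell^{BC}\parallel\ell^{B'C'}$, $A\ne C$, $A'\ne C'$, $\ell^{AB}\ne\ell^{A'B'}$, $\ell^{BC}\ne\ell^{B'C'}$, then $\ell^{AC}\parallel\ell^{A'C'}$. Here $\ell^{PQ}$ is the line through $P,Q$, and $\ell^{R}_{PQ}$ is the line through $R$ parallel to $\ell^{PQ}$. Fix a line $\ell^{OI}$ through two distinct points $O,I$. For $A,B\in\ell^{OI}$ and an auxiliary point $B_1\notin\ell^{OI}$: addition: $P_1=\ell^{B_1}_{OI}\cap\ell^{A}_{OB_1}$ and $A+B=\ell^{P_1}_{BB_1}\cap\ell^{OI}$; multiplication: $P_1=\ell^{A}_{IB_1}\cap\ell^{OB_1}$ and $A\cdot B=\ell^{P_1}_{BB_1}\cap\ell^{OI}$. It is known that $(\ell^{OI},+,\cdot)$ is a skew field (division ring) with zero $O$ and unit $I$. Cross-ratio: for four points $A,B,C,D\in\ell^{OI}$, no three of them equal, $c_r(A,B;C,D)=[(A-D)^{-1}(B-D)][(B-C)^{-1}(A-C)]$, computed in this skew field. The paper writes the cross-ratio for all $X\in\ell^{OI}$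 and gives no separate convention for a value of $X$ at which an inverse of $O$ would occur. The subscript $C$ in $f_C$ and superscript $C$ in $\mathcal{R}^{C}_4$ only indicate which of the four positions is variable. *)

(* Defs.v *)
From Stdlib Require Import List ClassicalEpsilon.
Import ListNotations.

Set Implicit Arguments.
Unset Strict Implicit.

Record affine_plane := {
  Point : Type;
  Line : Type;
  on : Point -> Line -> Prop;
  line_unique : forall P Q, P <> Q -> exists! l, on P l /\ on Q l;
  parallel_unique : forall P l, ~ on P l ->
    exists! m, on P m /\ forall X, ~ (on X l /\ on X m);
  noncollinear : exists P Q R, P <> Q /\ P <> R /\ Q <> R /\
    forall l, ~ (on P l /\ on Q l /\ on R l)
}.

Definition parallel (pi : affine_plane) (l m : Line pi) : Prop :=
  l = m \/ forall X, ~ (on X l /\ on X m).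

(* [join P Q l]: the line l^{PQ} exists (i.e. P <> Q) and is l. *)
Definition join (pi : affine_plane) (P Q : Point pi) (l : Line pi) : Prop :=
  P <> Q /\ on P l /\ on Q l.

Definition desargues (pi : affine_plane) : Prop :=
  forall (A B C A' B' C' : Point pi)
         (aa bb cc ab bc ac ab' bc' ac' : Line pi),
    join A A' aa -> join B B' bb -> join C C' cc ->
    join A B ab -> join B C bc -> join A C ac ->
    join A' B' ab' -> join B' C' bc' -> join A' C' ac' ->
    NoDup [aa; bb; cc; ac; ac'] ->
    ((parallel aa bb /\ parallel aa cc /\ parallel bb cc) \/
     (exists P, on P aa /\ on P bb /\ on P cc)) ->
    parallel ab ab' -> parallel bc bc' -> ab <> ab' -> bc <> bc' ->
    parallel ac ac'.

(* [on_join P Q X]: X lies on l^{PQ}. *)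
Definition on_join (pi : affine_plane) (P Q X : Point pi) : Prop :=
  exists l, join P Q l /\ on X l.

(* [on_parallel R P Q X]: X lies on l^R_{PQ}, the parallel to l^{PQ} through R. *)
Definition on_parallel (pi : affine_plane) (R P Q X : Point pi) : Prop :=
  exists l m, join P Q l /\ parallel l m /\ on R m /\ on X m.

Record line_point (pi : affine_plane) (l : Line pi) := {
  pt :> Point pi;
  pt_on : on pt l
}.

(* In the following definitions l is the line through O and I.  The auxiliary
   point B1 is any point off l; in a Desargues plane the constructed point does
   not depend on it, so [epsilon] selects a uniquely determined point. *)
Definition is_sum (pi : affine_plane) (l : Line pi) (O I A B S : line_point l)
    : Prop :=
  exists B1 P1 : Point pi,
    ~ on B1 l /\
    on_parallel B1 O I P1 /\ on_parallel A O B1 P1 /\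
    on_parallel P1 B B1 S.

Definition is_prod (pi : affine_plane) (l : Line pi) (O I A B S : line_point l)
    : Prop :=
  exists B1 P1 : Point pi,
    ~ on B1 l /\
    on_parallel A I B1 P1 /\ on_join O B1 P1 /\
    on_parallel P1 B B1 S.

Definition add (pi : affine_plane) (l : Line pi) (O I A B : line_point l)
    : line_point l :=
  epsilon (inhabits O) (is_sum O I A B).

Definition mul (pi : affine_plane) (l : Line pi) (O I A B : line_point l)
    : line_point l :=
  epsilon (inhabits O) (is_prod O I A B).

Definition opp (pi : affine_plane) (l : Line pi) (O I A : line_point l)
    : line_point l :=
  epsilon (inhabits O) (fun Y => add O I A Y = O /\ add O I Y A = O).

Definition sub (pi : affine_plane) (l : Line pi) (O I A B : line_point l)
    : line_point l :=
  add O I A (opp O I B).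

(* The zero point O has no inverse; W is an arbitrary value assigned to it, so
   that a result proved for every W does not rely on any convention. *)
Definition inv (pi : affine_plane) (l : Line pi) (O I W A : line_point l)
    : line_point l :=
  if excluded_middle_informative (A = O) then W
  else epsilon (inhabits O) (fun Y => mul O I A Y = I /\ mul O I Y A = I).

Definition cross_ratio (pi : affine_plane) (l : Line pi)
    (O I W A B C D : line_point l) : line_point l :=
  mul O I
    (mul O I (inv O I W (sub O I A D)) (sub O I B D))
    (mul O I (inv O I W (sub O I B C)) (sub O I A C)).

Definition f_C (pi : affine_plane) (l : Line pi)
    (O I W A B D X : line_point l) : line_point l :=
  cross_ratio O I W A B X D.

(* Main.v *)
(* Adding A on the left is the restriction to l of the translation along l that
   sends O to A: the little (parallel) case of Desargues' axiom produces these
   translations, they are determined by the image of one point and closed under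
   composition, whence associativity and the neutral element O.  Translations
   s, t along l commute because s commutes with a translation r in another
   direction and also with the composite t r, which has no fixed point.
   Finally f_C(A) = O, as its last factor is A - A = O. *)
From Stdlib Require Import Classical ClassicalEpsilon.
Require Import Defs.

Set Implicit Arguments.
Unset Strict Implicit.

(** * Incidence and parallelism in an affine plane *)

Lemma meet_unique (pi : affine_plane) (P Q : Point pi) (n k : Line pi) :
  n <> k -> on P n -> on P k -> on Q n -> on Q k -> P = Q.
Proof.
  intros hnk h1 h2 h3 h4. apply NNPP; intro hPQ.
  destruct (line_unique hPQ) as [j [_ hj]].
  apply hnk. rewrite <- (hj n), <- (hj k); auto.
Qed.

Lemma join_line_unique (pi : affine_plane) (P Q : Point pi) (n k : Line pi) :
  P <> Q -> on P n -> on Q n -> on P k -> on Q k -> n = k.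
Proof.
  intros hPQ h1 h2 h3 h4. apply NNPP; intro hnk.
  apply hPQ. exact (meet_unique hnk h1 h3 h2 h4).
Qed.

(** Covers [P = Q] as well, by joining [P] to some other point, so that later constructions need no
    case split. *)
Lemma line_through (pi : affine_plane) (P Q : Point pi) :
  exists n : Line pi, on P n /\ on Q n.
Proof.
  assert (aux : forall R S : Point pi, R <> S -> exists n, on R n /\ on S n).
  { intros R S h. destruct (line_unique h) as [n [hn _]]. now exists n. }
  destruct (classic (P = Q)) as [<- | h]; [| now apply aux].
  destruct (noncollinear pi) as (R & S & _ & hRS & _).
  destruct (classic (P = R)) as [-> | hPR].
  - destruct (aux _ _ hRS) as (n & hn & _). now exists n.
  - destruct (aux _ _ hPR) as (n & hn & _). now exists n.
Qed.

Lemma parallel_refl (pi : affine_plane) (n : Line pi) : parallel n n.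
Proof. now left. Qed.

Lemma parallel_sym (pi : affine_plane) (n k : Line pi) :
  parallel n k -> parallel k n.
Proof. intros [-> | h]; [now left | right; intros X []; now apply (h X)]. Qed.

Lemma parallel_on (pi : affine_plane) (n k : Line pi) (X : Point pi) :
  parallel n k -> on X n -> on X k -> n = k.
Proof. intros [h | h] h1 h2; [exact h | now destruct (h X)]. Qed.

Lemma not_parallel_meet (pi : affine_plane) (n k : Line pi) :
  ~ parallel n k -> exists X, on X n /\ on X k.
Proof.
  intro h. apply NNPP; intro hX. apply h. right. intros X hX'. apply hX. now exists X.
Qed.

(** If [n] and [j] met at a point off [k], both would be the unique parallel to [k] through that
    point. *)
Lemma parallel_trans (pi : affine_plane) (n k j : Line pi) :
  parallel n k -> parallel k j -> parallel n j.
Proof.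
  intros hnk hkj. destruct (classic (parallel n j)) as [h | h]; [exact h |].
  destruct (not_parallel_meet h) as (X & hn & hj).
  destruct hnk as [-> | hnk]; [exact hkj |].
  destruct hkj as [<- | hkj]; [now right |].
  assert (hX : ~ on X k) by (intro hk; now apply (hnk X)).
  destruct (parallel_unique hX) as [p [_ hp]].
  left. rewrite <- (hp n), <- (hp j); [reflexivity | |];
    (split; [assumption |]); intros Y []; [now apply (hkj Y) | now apply (hnk Y)].
Qed.

Lemma parallel_through (pi : affine_plane) (n : Line pi) (X : Point pi) :
  exists k, parallel n k /\ on X k.
Proof.
  destruct (classic (on X n)) as [h | h].
  - exists n. split; [apply parallel_refl | exact h].
  - destruct (parallel_unique h) as [k [[h1 h2] _]]. exists k. split; [now right | exact h1].
Qed.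

Lemma point_off (pi : affine_plane) (l : Line pi) : exists X, ~ on X l.
Proof.
  destruct (noncollinear pi) as (P & Q & R & _ & _ & _ & h).
  apply NNPP; intro hX. apply (h l).
  repeat split; apply NNPP; intro h'; apply hX; eauto.
Qed.

(** * The parallel class of a line as an equivalence relation on points *)

(** The classes of this relation are the lines parallel to [l], with [l] itself among them; stated
    on points, it spares naming those lines. *)
Definition level (pi : affine_plane) (l : Line pi) (X Y : Point pi) : Prop :=
  exists n, parallel l n /\ on X n /\ on Y n.

Lemma level_on (pi : affine_plane) (l n : Line pi) (X Y : Point pi) :
  level l X Y -> parallel l n -> on X n -> on Y n.
Proof.
  intros (k & hk & hX & hY) hn hXn.
  rewrite (@parallel_on _ n k X); auto.
  eapply parallel_trans; [apply parallel_sym |]; eassumption.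
Qed.

Lemma level_refl (pi : affine_plane) (l : Line pi) (X : Point pi) : level l X X.
Proof. destruct (parallel_through l X) as (n & h1 & h2). now exists n. Qed.

Lemma level_sym (pi : affine_plane) (l : Line pi) (X Y : Point pi) :
  level l X Y -> level l Y X.
Proof. intros (n & h1 & h2 & h3). now exists n. Qed.

Lemma level_trans (pi : affine_plane) (l : Line pi) (X Y Z : Point pi) :
  level l X Y -> level l Y Z -> level l X Z.
Proof.
  intros (n & h1 & h2 & h3) h. exists n.
  split; [exact h1 | split; [exact h2 | exact (level_on h h1 h3)]].
Qed.

(** A line transverse to [l] meets each parallel of [l] once. Most equalities of points below are
    obtained in this way. *)
Lemma level_not_parallel (pi : affine_plane) (l n : Line pi) (X Y : Point pi) :
  ~ parallel l n -> on X n -> on Y n -> level l X Y -> X = Y.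
Proof.
  intros hn hX hY (k & hk & hXk & hYk).
  apply (@meet_unique _ X Y n k); auto. now intros ->.
Qed.

Lemma not_level_not_parallel (pi : affine_plane) (l n : Line pi) (X Y : Point pi) :
  ~ level l X Y -> on X n -> on Y n -> ~ parallel l n.
Proof. intros h hX hY hn. apply h. now exists n. Qed.

(** * Parallelograms with two sides along a fixed direction *)

(** A parallelogram on two different carriers parallel to [l], with the degenerate case [P = P']
    allowed: [X'] is where the translation taking [P] to [P'] has to send [X]. *)
Definition para (pi : affine_plane) (l : Line pi) (P P' X X' : Point pi) : Prop :=
  level l P P' /\ level l X X' /\ ~ level l P X /\
  exists n n', parallel n n' /\ on P n /\ on X n /\ on P' n' /\ on X' n'.

Lemma para_sym (pi : affine_plane) (l : Line pi) (P P' X X' : Point pi) :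
  para l P P' X X' -> para l X X' P P'.
Proof.
  intros (h1 & h2 & h3 & n & n' & h). repeat split; auto.
  - intro h4. now apply h3, level_sym.
  - exists n, n'. tauto.
Qed.

(** The parallel to [P X] through [P'] is transverse to [l], so it meets the carrier of [X]. *)
Lemma para_exists (pi : affine_plane) (l : Line pi) (P P' X : Point pi) :
  level l P P' -> ~ level l P X -> exists X', para l P P' X X'.
Proof.
  intros hP hX. destruct (line_through P X) as (n & hPn & hXn).
  destruct (parallel_through n P') as (n' & hn' & hP').
  destruct (parallel_through l X) as (k & hk & hXk).
  assert (hnk : ~ parallel n' k).
  { intro h. apply (not_level_not_parallel hX hPn hXn).
    apply (parallel_trans hk). apply parallel_sym. now apply (parallel_trans hn'). }
  destruct (not_parallel_meet hnk) as (X' & h1 & h2).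
  exists X'. repeat split; auto.
  - now exists k.
  - now exists n, n'.
Qed.

Lemma para_fixed (pi : affine_plane) (l : Line pi) (P X X' : Point pi) :
  para l P P X X' -> X = X'.
Proof.
  intros (_ & hX & hPX & n & n' & hn & h1 & h2 & h3 & h4).
  rewrite <- (parallel_on hn h1 h3) in h4.
  exact (level_not_parallel (not_level_not_parallel hPX h1 h2) h2 h4 hX).
Qed.

(* The nondegeneracy conditions of Desargues' axiom are automatic for three
   distinct parallel carriers and non-fixed vertices. *)
Lemma para_trans (pi : affine_plane) (hdes : desargues pi) (l : Line pi)
    (P P' X X' Y Y' : Point pi) :
  para l P P' X X' -> para l X X' Y Y' -> ~ level l P Y -> para l P P' Y Y'.
Proof.
  intros hPX hXY hPY.
  (* One fixed vertex forces all three to be fixed, and a single line through [P] and [Y] then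
     serves for both sides. *)
  destruct (classic (X = X')) as [<- | hX].
  { rewrite <- (para_fixed (para_sym hPX)), <- (para_fixed hXY).
    destruct (line_through P Y) as (n & h1 & h2).
    repeat split; try apply level_refl; auto.
    exists n, n. repeat split; auto. apply parallel_refl. }
  assert (hP : P <> P') by (intros <-; exact (hX (para_fixed hPX))).
  assert (hY : Y <> Y') by (intros <-; apply hX; exact (para_fixed (para_sym hXY))).
  destruct hPX as (lP & lX & nPX & n1 & n1' & p1 & a1 & a2 & a3 & a4).
  destruct hXY as (_ & lY & nXY & n2 & n2' & p2 & b1 & b2 & b3 & b4).
  repeat split; auto.
  destruct (line_through P Y) as (n3 & c1 & c2).
  destruct (line_through P' Y') as (n3' & c3 & c4).
  exists n3, n3'. repeat split; auto.
  assert (nPX' : ~ level l P' X').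
  { intro h. apply nPX. apply (level_trans lP), (level_trans h). now apply level_sym. }
  assert (nXY' : ~ level l X' Y').
  { intro h. apply nXY. apply (level_trans lX), (level_trans h). now apply level_sym. }
  assert (nPY' : ~ level l P' Y').
  { intro h. apply hPY. apply (level_trans lP), (level_trans h). now apply level_sym. }
  assert (ne : forall U V : Point pi, ~ level l U V -> U <> V).
  { intros U V h <-. apply h, level_refl. }
  destruct lP as (p & pp & pP & pP').
  destruct lX as (x & px & xX & xX').
  destruct lY as (y & py & yY & yY').
  assert (hpx : p <> x) by (intros ->; apply nPX; now exists x).
  assert (hxy : x <> y) by (intros ->; apply nXY; now exists y).
  assert (hpy : p <> y) by (intros ->; apply hPY; now exists y).
  assert (q1 := not_level_not_parallel nPX a1 a2).
  assert (q2 := not_level_not_parallel nXY b1 b2).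
  assert (q3 := not_level_not_parallel hPY c1 c2).
  assert (q3' := not_level_not_parallel nPY' c3 c4).
  assert (d3 : n3 <> n3').
  { intros <-. apply hP. apply (level_not_parallel q3 c1 c3). now exists p. }
  apply (hdes P X Y P' X' Y' p x y n1 n2 n3 n1' n2' n3');
    try (split; [now auto | now auto]).
  (* The carriers are parallel to [l] while [n3] and [n3'] are not, which separates the two groups
     in the [NoDup] list. *)
  - assert (forall k, parallel l k -> k <> n3) by (intros k h ->; auto).
    assert (forall k, parallel l k -> k <> n3') by (intros k h ->; auto).
    repeat (constructor; [simpl; intuition (subst; eauto; congruence) |]).
    constructor.
  - left. assert (aux : forall k j, parallel l k -> parallel l j -> parallel k j).
    { intros k j hk hj. exact (parallel_trans (parallel_sym hk) hj). }
    auto.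
  - exact p1.
  - exact p2.
  - intros <-. apply hP. apply (level_not_parallel q1 a1 a3). now exists p.
  - intros <-. apply hX. apply (level_not_parallel q2 b1 b3). now exists x.
Qed.

(** * Transport of a point by a pair, through auxiliary parallelograms *)

(** Excludes the plane of order two, where each parallel class has only two lines and there is no
    room for auxiliary points. *)
Definition three_levels (pi : affine_plane) (l : Line pi) : Prop :=
  exists P Q R, ~ level l P Q /\ ~ level l P R /\ ~ level l Q R.

(** Pigeonhole: otherwise two of the three given points would share the level of [X] or that of
    [Y]. *)
Lemma off_two_levels (pi : affine_plane) (l : Line pi) :
  three_levels l -> forall X Y, exists Z, ~ level l X Z /\ ~ level l Y Z.
Proof.
  intros (P & Q & R & h1 & h2 & h3) X Y. apply NNPP; intro h.
  assert (aux : forall Z, level l X Z \/ level l Y Z).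
  { intro Z. apply NNPP; intro hZ. apply h. exists Z. tauto. }
  assert (lt : forall U V W, level l U V -> level l U W -> level l V W).
  { intros U V W hV hW. exact (level_trans (level_sym hV) hW). }
  destruct (aux P), (aux Q), (aux R); eauto.
Qed.

(* Going through an auxiliary pair (E, E') allows X to lie at the level of P. *)
Definition shift (pi : affine_plane) (l : Line pi) (P P' X X' : Point pi) : Prop :=
  exists E E', para l P P' E E' /\ para l E E' X X'.

Lemma shift_exists (pi : affine_plane) (l : Line pi) (h3 : three_levels l)
    (P P' X : Point pi) : level l P P' -> exists X', shift l P P' X X'.
Proof.
  intro hP. destruct (off_two_levels h3 P X) as (E & hE1 & hE2).
  destruct (para_exists hP hE1) as (E' & hE).
  destruct (@para_exists _ l E E' X) as (X' & hX).
  - apply hE.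
  - intro h. now apply hE2, level_sym.
  - now exists X', E, E'.
Qed.

Lemma shift_para (pi : affine_plane) (hdes : desargues pi) (l : Line pi)
    (P P' X X' : Point pi) :
  shift l P P' X X' -> ~ level l P X -> para l P P' X X'.
Proof. intros (E & E' & h1 & h2) h. exact (para_trans hdes h1 h2 h). Qed.

(** Going to [E] and back, [Q] lands on the line [P' E'] at the level of [P'], hence on [P']
    itself. *)
Lemma shift_self (pi : affine_plane) (l : Line pi) (P P' Q : Point pi) :
  shift l P P' P Q -> Q = P'.
Proof.
  intros (E & E' & (lP & _ & nPE & n & n' & h1 & h2 & h3 & h4 & h5)
                 & (_ & lQ & _ & k & k' & g1 & g2 & g3 & g4 & g5)).
  assert (hne : P <> E) by (intros <-; apply nPE, level_refl).
  rewrite (join_line_unique hne g3 g2 h2 h3) in g1.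
  rewrite (parallel_on (parallel_trans (parallel_sym g1) h1) g4 h5) in g5.
  assert (hn := not_level_not_parallel nPE h2 h3).
  apply (@level_not_parallel _ l n'); auto.
  - intro h. exact (hn (parallel_trans h (parallel_sym h1))).
  - exact (level_trans (level_sym lQ) lP).
Qed.

(** Any two values of the transport fit together, whichever auxiliary pairs produced them; the
    parallelograms are chained with [para_trans]. *)
Lemma shift_para2 (pi : affine_plane) (hdes : desargues pi) (l : Line pi)
    (h3 : three_levels l) (P P' X X' Y Y' : Point pi) :
  shift l P P' X X' -> shift l P P' Y Y' -> ~ level l X Y -> para l X X' Y Y'.
Proof.
  (* If [X] is on the level of [P], the pair [P], [P'] cannot be a link of the chain, and [E], [E']
     takes its place. *)
  assert (aux : forall X X' Y Y', level l P X -> ~ level l X Y ->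
    shift l P P' X X' -> shift l P P' Y Y' -> para l X X' Y Y').
  { clear X X' Y Y'. intros X X' Y Y' hPX hXY (E & E' & hE1 & hE2) hY.
    assert (hPY : ~ level l P Y).
    { intro h. exact (hXY (level_trans (level_sym hPX) h)). }
    apply (shift_para hdes) in hY; [| exact hPY].
    destruct (off_two_levels h3 P Y) as (F & hF1 & hF2).
    destruct (classic (level l E Y)) as [hEY | hEY].
    (* Here [E] shares the level of [Y], so it cannot be linked to [Y] directly. The point [F]
       avoids the levels of [P] and [Y], hence those of [X] and [E], and links [X] to [Y]. *)
    - destruct (@para_exists _ l P P' F) as (F' & hF); [apply hE1 | exact hF1 |].
      assert (hEF : ~ level l E F).
      { intro h. exact (hF2 (level_trans (level_sym hEY) h)). }
      assert (hXF : ~ level l X F).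
      { intro h. exact (hF1 (level_trans hPX h)). }
      assert (h1 := para_trans hdes (para_sym hE1) hF hEF).
      assert (h2 := para_trans hdes (para_sym hE2) h1 hXF).
      assert (h4 : para l F F' Y Y').
      { apply (para_trans hdes (para_sym hF) hY). intro h. now apply hF2, level_sym. }
      exact (para_trans hdes h2 h4 hXY).
    - exact (para_trans hdes (para_sym hE2)
               (para_trans hdes (para_sym hE1) hY hEY) hXY). }
  intros hX hY hXY.
  destruct (classic (level l P X)) as [hPX | hPX]; [now apply aux |].
  destruct (classic (level l P Y)) as [hPY | hPY].
  - apply para_sym, aux; auto. intro h. now apply hXY, level_sym.
  - exact (para_trans hdes (para_sym (shift_para hdes hX hPX))
             (shift_para hdes hY hPY) hXY).
Qed.

(** * Translations: existence and uniqueness *)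

(* Constant maps are not excluded; they do not preserve levels. *)
Definition dilation (pi : affine_plane) (t : Point pi -> Point pi) : Prop :=
  forall X Y n n', on X n -> on Y n -> parallel n n' -> on (t X) n' -> on (t Y) n'.

Definition translation (pi : affine_plane) (l : Line pi)
    (t : Point pi -> Point pi) : Prop :=
  dilation t /\ forall X, level l X (t X).

Lemma dilation_comp (pi : affine_plane) (s t : Point pi -> Point pi) :
  dilation s -> dilation t -> dilation (fun X => s (t X)).
Proof.
  intros hs ht X Y n n' hX hY hn hst.
  destruct (parallel_through n (t X)) as (k & hk & hXk).
  apply (hs (t X) (t Y) k); auto.
  - exact (ht X Y n k hX hY hk hXk).
  - exact (parallel_trans (parallel_sym hk) hn).
Qed.

Lemma translation_comp (pi : affine_plane) (l : Line pi)
    (s t : Point pi -> Point pi) :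
  translation l s -> translation l t -> translation l (fun X => s (t X)).
Proof.
  intros [hs ls] [ht lt]. split; [now apply dilation_comp |].
  intro X. exact (level_trans (lt X) (ls (t X))).
Qed.

Lemma translation_id (pi : affine_plane) (l : Line pi) :
  translation l (fun X => X).
Proof.
  split; [| apply level_refl].
  intros X Y n n' h1 h2 h3 h4. now rewrite <- (parallel_on h3 h1 h4).
Qed.

Lemma translation_exists (pi : affine_plane) (hdes : desargues pi) (l : Line pi)
    (h3 : three_levels l) (P P' : Point pi) :
  level l P P' -> exists t, translation l t /\ t P = P'.
Proof.
  intro hP.
  (* An arbitrary choice at each point is enough, since [shift_para2] relates all possible
     values. *)
  pose (t := fun X => epsilon (inhabits X) (shift l P P' X)).
  assert (ht : forall X, shift l P P' X (t X)).
  { intro X. apply epsilon_spec. now apply shift_exists. }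
  assert (lt : forall X, level l X (t X)).
  { intro X. destruct (ht X) as (E & E' & _ & h). apply h. }
  exists t. split; [split; [| exact lt] | exact (shift_self (ht P))].
  intros X Y n n' hX hY hn hX'.
  destruct (classic (level l X Y)) as [hXY | hXY].
  - destruct (classic (X = Y)) as [<- | hne]; [exact hX' |].
    assert (hln : parallel l n).
    { apply NNPP; intro h. exact (hne (level_not_parallel h hX hY hXY)). }
    refine (level_on _ (parallel_trans hln hn) hX').
    apply (level_trans (level_sym (lt X))), (level_trans hXY), lt.
  - destruct (shift_para2 hdes h3 (ht X) (ht Y) hXY)
      as (_ & _ & _ & k & k' & p & a1 & a2 & a3 & a4).
    assert (hne : X <> Y) by (intros <-; apply hXY, level_refl).
    rewrite (join_line_unique hne hX hY a1 a2) in hn.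
    now rewrite (parallel_on (parallel_trans (parallel_sym hn) p) hX' a3).
Qed.

(** Both images of [Y] lie on the parallel to [X Y] through [s X], which is transverse to [l], and
    on the level of [Y]. *)
Lemma translation_unique_off (pi : affine_plane) (l : Line pi)
    (s t : Point pi -> Point pi) (X Y : Point pi) :
  translation l s -> translation l t -> s X = t X -> ~ level l X Y -> s Y = t Y.
Proof.
  intros [hs ls] [ht lt] hX hXY.
  destruct (line_through X Y) as (n & h1 & h2).
  destruct (parallel_through n (s X)) as (n' & h3 & h4).
  assert (hn : ~ parallel l n').
  { intro h. apply (not_level_not_parallel hXY h1 h2).
    exact (parallel_trans h (parallel_sym h3)). }
  apply (level_not_parallel hn).
  - exact (hs X Y n n' h1 h2 h3 h4).
  - rewrite hX in h4. exact (ht X Y n n' h1 h2 h3 h4).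
  - exact (level_trans (level_sym (ls Y)) (lt Y)).
Qed.

Lemma exists_not_level (pi : affine_plane) (l : Line pi) (X : Point pi) :
  exists Y, ~ level l X Y.
Proof.
  destruct (parallel_through l X) as (n & hn & hX).
  destruct (point_off n) as (Y & hY). exists Y.
  intro h. exact (hY (level_on h hn hX)).
Qed.

Lemma translation_unique (pi : affine_plane) (l : Line pi)
    (s t : Point pi -> Point pi) (X : Point pi) :
  translation l s -> translation l t -> s X = t X -> forall Y, s Y = t Y.
Proof.
  intros hs ht hX Y.
  destruct (classic (level l X Y)) as [hXY | hXY];
    [| exact (translation_unique_off hs ht hX hXY)].
  (* Agreement passes from [X] to [Z] and back to [Y], each time between different levels. *)
  destruct (exists_not_level l X) as (Z & hZ).
  apply (@translation_unique_off _ l s t Z Y); auto.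
  - exact (translation_unique_off hs ht hX hZ).
  - intro h. exact (hZ (level_trans hXY (level_sym h))).
Qed.

(** * Commutation of translations *)

(** Both composites give the fourth vertex of the parallelogram on [X], [s X], [r X]. *)
Lemma translation_comm_transversal (pi : affine_plane) (l m : Line pi)
    (s r : Point pi -> Point pi) :
  ~ parallel l m -> translation l s -> translation m r ->
  forall X, s (r X) = r (s X).
Proof.
  intros hlm [hs ls] [hr lr] X.
  destruct (parallel_through m (s X)) as (n & hn & hsX).
  assert (hln : ~ parallel l n).
  { intro h. apply hlm. exact (parallel_trans h (parallel_sym hn)). }
  apply (level_not_parallel hln).
  - destruct (parallel_through m X) as (k & hk & hX).
    apply (hs X (r X) k n); auto.
    + exact (level_on (lr X) hk hX).
    + exact (parallel_trans (parallel_sym hk) hn).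
  - exact (level_on (lr (s X)) hn hsX).
  - apply (level_trans (level_sym (ls (r X)))).
    destruct (parallel_through l X) as (k & hk & hX).
    destruct (parallel_through l (r X)) as (k' & hk' & hrX).
    exists k'. split; [exact hk' | split; [exact hrX |]].
    apply (hr X (s X) k k'); auto.
    + exact (level_on (ls X) hk hX).
    + exact (parallel_trans (parallel_sym hk) hk').
Qed.

(* As d has no fixed point, the lines X (d X) and (s X) (d (s X)) are parallel:
   a common point of two traces of d would be fixed. *)
Lemma translation_comm_dilation (pi : affine_plane) (l : Line pi)
    (s d : Point pi -> Point pi) :
  translation l s -> dilation d -> (forall X, ~ level l X (d X)) ->
  forall X, s (d X) = d (s X).
Proof.
  intros [hs ls] hd nd X.
  destruct (line_through X (d X)) as (k & k1 & k2).
  destruct (line_through (s X) (d (s X))) as (k' & k1' & k2').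
  assert (hk : parallel k k').
  { apply NNPP; intro h. destruct (not_parallel_meet h) as (V & hV & hV').
    apply (nd V).
    rewrite <- (@meet_unique _ V (d V) k k'); auto using level_refl.
    - intros <-. apply h, parallel_refl.
    - exact (hd X V k k k1 hV (parallel_refl k) k2).
    - exact (hd (s X) V k' k' k1' hV' (parallel_refl k') k2'). }
  (* Both points lie on [k'], which is transverse to [l], and on the parallel to [l] through
     [d X]. *)
  apply (level_not_parallel (not_level_not_parallel (nd (s X)) k1' k2')).
  - exact (hs X (d X) k k' k1 k2 hk k1').
  - exact k2'.
  - apply (level_trans (level_sym (ls (d X)))).
    destruct (parallel_through l X) as (n & hn & hX).
    destruct (parallel_through l (d X)) as (n' & hn' & hdX).
    exists n'. split; [exact hn' | split; [exact hdX |]].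
    apply (hd X (s X) n n'); auto.
    + exact (level_on (ls X) hn hX).
    + exact (parallel_trans (parallel_sym hn) hn').
Qed.

Lemma translation_comm (pi : affine_plane) (hdes : desargues pi) (l m : Line pi)
    (s t : Point pi -> Point pi) :
  ~ parallel l m -> three_levels m -> translation l s -> translation l t ->
  forall X, s (t X) = t (s X).
Proof.
  intros hlm h3 hs ht.
  destruct (noncollinear pi) as (O & _).
  destruct (exists_not_level l O) as (E & hE).
  destruct (parallel_through m O) as (k & hk & hO).
  destruct (parallel_through l E) as (j & hj & hEj).
  assert (hkj : ~ parallel k j).
  { intro h. apply hlm. apply (parallel_trans hj), parallel_sym.
    exact (parallel_trans hk h). }
  destruct (not_parallel_meet hkj) as (O' & h1 & h2).
  assert (hOO' : ~ level l O O').
  { intro h. apply hE. apply (level_trans h). now exists j. }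
  destruct (@translation_exists _ hdes m h3 O O') as (r & hr & hrO).
  { now exists k. }
  (* A point level with its image under [r] would be fixed, as [r] moves points along [m]; then [r]
     would be the identity, against [r O = O']. *)
  assert (nr : forall X, ~ level l X (r X)).
  { intros X h. apply hOO'. rewrite <- hrO.
    rewrite (@translation_unique _ m r (fun Y => Y) X hr (translation_id m));
      [apply level_refl |].
    destruct (proj2 hr X) as (n & hn & g1 & g2). symmetry.
    apply (@level_not_parallel _ l n); auto.
    intro g. apply hlm. exact (parallel_trans g (parallel_sym hn)). }
  (* Agreement at [r O] suffices: [s (t (r O)) = t (r (s O)) = t (s (r O))]. *)
  apply (@translation_unique _ l _ _ (r O)); try now apply translation_comp.
  rewrite (@translation_comm_transversal _ l m s r hlm hs hr).
  apply (@translation_comm_dilation _ l s (fun X => t (r X)) hs).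
  - exact (dilation_comp (proj1 ht) (proj1 hr)).
  - intros X h. apply (nr X). apply (level_trans h), level_sym, ht.
Qed.

(** * Three parallels obtained from three collinear points *)

Lemma three_levels_transversal (pi : affine_plane) (l m : Line pi)
    (A B C : Point pi) :
  ~ parallel m l -> on A l -> on B l -> on C l -> A <> B -> A <> C -> B <> C ->
  three_levels m.
Proof.
  intros hml hA hB hC hAB hAC hBC. exists A, B, C.
  assert (hl : forall X Y, on X l -> on Y l -> level m X Y -> X = Y)
    by exact (fun X Y => level_not_parallel hml).
  repeat split; intro h; eauto.
Qed.

(** One level is [l], the second passes through a point [E] off [l]. The third passes through the
    intersection [Z] of [E B] with the parallel to [C E] through [A]. *)
Lemma three_levels_self (pi : affine_plane) (l : Line pi) (A B C : Point pi) :
  on A l -> on B l -> on C l -> A <> B -> A <> C -> B <> C -> three_levels l.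
Proof.
  intros hA hB hC hAB hAC hBC.
  destruct (point_off l) as (E & hE).
  destruct (line_through C E) as (n & n1 & n2).
  destruct (line_through E B) as (j & j1 & j2).
  destruct (parallel_through n A) as (k & k1 & k2).
  assert (hn : ~ on A n).
  { intro h. apply hE. now rewrite (join_line_unique hAC hA hC h n1). }
  assert (hnj : n <> j).
  { intros <-. apply hE. now rewrite (join_line_unique hBC hB hC j2 n1). }
  assert (hkj : ~ parallel k j).
  { intro h. apply hnj. exact (parallel_on (parallel_trans k1 h) n2 j1). }
  destruct (not_parallel_meet hkj) as (Z & z1 & z2).
  assert (hZ : ~ on Z l).
  (* On [l], the point [Z] would be the trace of [k], which is [A], and the trace of [j], which is
     [B]. *)
  { intro h. apply hAB. transitivity Z.
    - apply (@meet_unique _ A Z k l); auto. intros ->.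
      apply hn. now rewrite (parallel_on k1 n1 hC).
    - apply (@meet_unique _ Z B j l); auto. intros ->. auto. }
  assert (hl : forall X Y, level l X Y -> on X l -> on Y l).
  { intros X Y h. exact (level_on h (parallel_refl l)). }
  exists C, E, Z. repeat split; intro h; eauto.
  assert (hlj : ~ parallel l j).
  { intro h'. apply hE. now rewrite (parallel_on h' hB j2). }
  rewrite <- (level_not_parallel hlj j1 z2 h) in z1.
  apply hn. now rewrite (parallel_on k1 n2 z1).
Qed.

(** * Addition of points read as translation *)

Lemma pt_inj (pi : affine_plane) (l : Line pi) (A B : line_point l) :
  pt A = pt B -> A = B.
Proof.
  destruct A as [A hA], B as [B hB]; simpl. intros <-.
  now rewrite (proof_irrelevance _ hA hB).
Qed.

Lemma join_on_line (pi : affine_plane) (l k : Line pi) (O I : line_point l) :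
  join O I k -> k = l.
Proof.
  intros (h1 & h2 & h3). exact (join_line_unique h1 h2 h3 (pt_on O) (pt_on I)).
Qed.

Lemma off_line_neq (pi : affine_plane) (l : Line pi) (A : line_point l) (B : Point pi) :
  ~ on B l -> pt A <> B.
Proof. intros h <-. exact (h (pt_on A)). Qed.

Lemma translation_on (pi : affine_plane) (l : Line pi) (t : Point pi -> Point pi)
    (A : line_point l) : translation l t -> on (t A) l.
Proof. intros [_ h]. exact (level_on (h A) (parallel_refl l) (pt_on A)). Qed.

(** The construction draws two parallelograms of [t]: the first takes [B1] to [P1], the second takes
    [B] to [S]. This gives at once existence of the sum and its independence of [B1]. *)
Lemma is_sum_translation (pi : affine_plane) (l : Line pi) (O I A B S : line_point l)
    (t : Point pi -> Point pi) :
  O <> I -> translation l t -> t O = A -> is_sum O I A B S <-> pt S = t B.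
Proof.
  intros hOI ht hO. assert (hOI' : pt O <> pt I) by (intro h; exact (hOI (pt_inj h))).
  split.
  - intros (B1 & P1 & hB1 & (k & k' & c1 & c2 & c3 & c4)
      & (j & j' & d1 & d2 & d3 & d4) & (i & i' & e1 & e2 & e3 & e4)).
    rewrite (join_on_line c1) in c2. clear c1.
    destruct d1 as (_ & d1 & d1'). destruct e1 as (_ & e1 & e1').
    assert (hlj : ~ parallel l j).
    { intro h. apply hB1. now rewrite (parallel_on h (pt_on O) d1). }
    assert (hli : ~ parallel l i).
    { intro h. apply hB1. now rewrite (parallel_on h (pt_on B) e1). }
    destruct ht as [dt lt].
    assert (hP1 : P1 = t B1).
    { apply (@level_not_parallel _ l j'); auto.
      - intro h. exact (hlj (parallel_trans h (parallel_sym d2))).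
      - apply (dt O B1 j); auto. now rewrite hO.
      - apply (@level_trans _ l _ B1); [now exists k' | apply lt]. }
    rewrite hP1 in e3.
    apply (@level_not_parallel _ l i'); auto.
    + intro h. exact (hli (parallel_trans h (parallel_sym e2))).
    + exact (dt B1 B i i' e1' e1 e2 e3).
    + exists l. split; [apply parallel_refl | split; [apply pt_on |]].
      now apply translation_on.
  - intro hS. destruct (point_off l) as (B1 & hB1).
    exists B1, (t B1). split; [exact hB1 |]. repeat split.
    + destruct (parallel_through l B1) as (k & hk & hB1k).
      exists l, k. repeat split; auto using pt_on.
      exact (level_on (proj2 ht B1) hk hB1k).
    + destruct (line_through O B1) as (j & j1 & j2).
      destruct (parallel_through j A) as (j' & hj & hA).
      exists j, j'. repeat split; auto using off_line_neq.
      apply (proj1 ht O B1 j); auto. now rewrite hO.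
    + destruct (line_through B B1) as (j & j1 & j2).
      destruct (parallel_through j (t B1)) as (j' & hj & hA).
      exists j, j'. repeat split; auto using off_line_neq.
      rewrite hS. now apply (proj1 ht B1 B j).
Qed.

(** The point [t B] satisfies [is_sum], so the value chosen by [epsilon] satisfies it too and must
    be [t B]. *)
Lemma add_translation (pi : affine_plane) (l : Line pi) (O I A B : line_point l)
    (t : Point pi -> Point pi) :
  O <> I -> translation l t -> t O = A -> pt (add O I A B) = t B.
Proof.
  intros hOI ht hO.
  apply (is_sum_translation B (add O I A B) hOI ht hO).
  apply (epsilon_spec (inhabits O) (is_sum O I A B)).
  exists (Build_line_point (translation_on B ht)).
  now apply (is_sum_translation _ _ hOI ht hO).
Qed.

Lemma line_translation (pi : affine_plane) (hdes : desargues pi) (l : Line pi)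
    (h3 : three_levels l) (A B : line_point l) :
  exists t, translation l t /\ t A = B.
Proof.
  apply translation_exists; auto. exists l. auto using parallel_refl, pt_on.
Qed.

Lemma add_assoc (pi : affine_plane) (hdes : desargues pi) (l : Line pi)
    (h3 : three_levels l) (O I : line_point l) (hOI : O <> I) (A B C : line_point l) :
  add O I (add O I A B) C = add O I A (add O I B C).
Proof.
  destruct (line_translation hdes h3 O A) as (s & hs & sO).
  destruct (line_translation hdes h3 O B) as (t & ht & tO).
  apply pt_inj.
  rewrite (@add_translation _ _ O I A (add O I B C) s hOI hs sO).
  rewrite (@add_translation _ _ O I B C t hOI ht tO).
  (* The composite sends [O] to the sum of [A] and [B], hence computes the left side. *)
  apply (@add_translation _ _ O I (add O I A B) C (fun X => s (t X)) hOI).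
  - now apply translation_comp.
  - rewrite tO. symmetry. now apply add_translation.
Qed.

Lemma add_comm (pi : affine_plane) (hdes : desargues pi) (l m : Line pi)
    (h3 : three_levels l) (hlm : ~ parallel l m) (h3m : three_levels m)
    (O I : line_point l) (hOI : O <> I) (A B : line_point l) :
  add O I A B = add O I B A.
Proof.
  destruct (line_translation hdes h3 O A) as (s & hs & sO).
  destruct (line_translation hdes h3 O B) as (t & ht & tO).
  apply pt_inj.
  rewrite (@add_translation _ _ O I A B s hOI hs sO), <- tO.
  rewrite (@add_translation _ _ O I B A t hOI ht tO), <- sO.
  exact (translation_comm hdes hlm h3m hs ht O).
Qed.

Lemma add_zero (pi : affine_plane) (hdes : desargues pi) (l : Line pi)
    (h3 : three_levels l) (O I : line_point l) (hOI : O <> I) (A : line_point l) :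
  add O I A O = A.
Proof.
  destruct (line_translation hdes h3 O A) as (s & hs & sO).
  apply pt_inj. rewrite <- sO. now apply add_translation.
Qed.

Lemma sub_self (pi : affine_plane) (hdes : desargues pi) (l m : Line pi)
    (h3 : three_levels l) (hlm : ~ parallel l m) (h3m : three_levels m)
    (O I : line_point l) (hOI : O <> I) (A : line_point l) :
  sub O I A A = O.
Proof.
  assert (h : exists Y, add O I A Y = O /\ add O I Y A = O).
  (* The translation taking [A] to [O] takes [O] to the opposite of [A]; this witness makes the
     choice in [opp] meaningful. *)
  { destruct (line_translation hdes h3 A O) as (t & ht & tA).
    exists (Build_line_point (translation_on O ht)).
    rewrite (add_comm hdes h3 hlm h3m hOI A).
    split; apply pt_inj; rewrite <- tA; now apply add_translation. }
  exact (proj1 (epsilon_spec (inhabits O) _ h)).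
Qed.

(** * Multiplication by zero on the right *)

(** With second factor [O] the last line is parallel to [O B1] through [P1], a point of [O B1]; so
    it is [O B1] itself and meets [l] only in [O]. *)
Lemma is_prod_zero (pi : affine_plane) (l : Line pi) (O I A S : line_point l) :
  O <> I -> is_prod O I A O S <-> S = O.
Proof.
  intro hOI. assert (hOI' : pt O <> pt I) by (intro h; exact (hOI (pt_inj h))).
  split.
  - intros (B1 & P1 & hB1 & _ & (j & (j0 & j1 & j2) & j3)
      & (i & i' & (_ & i1 & i2) & i3 & i4 & i5)).
    rewrite <- (join_line_unique j0 j1 j2 i1 i2) in i3.
    rewrite <- (parallel_on i3 j3 i4) in i5.
    apply pt_inj. apply (@meet_unique _ S O j l); auto using pt_on.
    now intros ->.
  - intros ->. destruct (point_off l) as (B1 & hB1).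
    destruct (line_through O B1) as (j & j1 & j2).
    destruct (line_through I B1) as (k & k1 & k2).
    destruct (parallel_through k A) as (k' & hk & hA).
    (* Otherwise [I B1] and [O B1] would coincide and [B1] would lie on [l]. *)
    assert (hkj : ~ parallel k' j).
    { intro h. apply hB1.
      rewrite (parallel_on (parallel_trans hk h) k2 j2) in k1.
      now rewrite (join_line_unique hOI' (pt_on O) (pt_on I) j1 k1). }
    destruct (not_parallel_meet hkj) as (P1 & p1 & p2).
    exists B1, P1. split; [exact hB1 |]. repeat split.
    + exists k, k'. repeat split; auto using off_line_neq.
    + exists j. repeat split; auto using off_line_neq.
    + exists j, j. repeat split; auto using off_line_neq, parallel_refl.
Qed.

Lemma mul_zero (pi : affine_plane) (l : Line pi) (O I A : line_point l) :
  O <> I -> mul O I A O = O.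
Proof.
  intro hOI. apply (is_prod_zero A _ hOI).
  apply (epsilon_spec (inhabits O) (is_prod O I A O)).
  exists O. now apply is_prod_zero.
Qed.

Theorem theorem7 (pi : affine_plane) (hdes : desargues pi)
    (l : Line pi) (O I : line_point l) (hOI : O <> I)
    (W : line_point l)
    (A B D : line_point l)
    (hAB : A <> B) (hAD : A <> D) (hBD : B <> D)
    (hAO : A <> O) (hBO : B <> O) (hDO : D <> O) :
  (forall X Y Z : line_point l,
     add O I (add O I (f_C O I W A B D X) (f_C O I W A B D Y))
       (f_C O I W A B D Z) =
     add O I (f_C O I W A B D X)
       (add O I (f_C O I W A B D Y) (f_C O I W A B D Z))) /\
  (forall X Y : line_point l,
     add O I (f_C O I W A B D X) (f_C O I W A B D Y) =
     add O I (f_C O I W A B D Y) (f_C O I W A B D X)) /\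
  (exists Z : line_point l, forall X : line_point l,
     add O I (f_C O I W A B D X) (f_C O I W A B D Z) = f_C O I W A B D X).
Proof.
  assert (pAB : pt A <> pt B) by (intro h; exact (hAB (pt_inj h))).
  assert (pAD : pt A <> pt D) by (intro h; exact (hAD (pt_inj h))).
  assert (pBD : pt B <> pt D) by (intro h; exact (hBD (pt_inj h))).
  (* The three distinct points [A], [B], [D] rule out the plane of order two, for the direction [l]
     here and for a transverse direction [m] below. *)
  assert (h3 : three_levels l)
    by exact (three_levels_self (pt_on A) (pt_on B) (pt_on D) pAB pAD pBD).
  assert (hm : exists m, ~ parallel l m).
  { destruct (point_off l) as (E & hE). destruct (line_through O E) as (m & m1 & m2).
    exists m. intro h. apply hE. now rewrite (parallel_on h (pt_on O) m1). }
  destruct hm as (m & hlm).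
  assert (h3m : three_levels m).
  { apply (@three_levels_transversal _ l m A B D); auto using pt_on.
    intro h. exact (hlm (parallel_sym h)). }
  split; [| split].
  - intros X Y Z. now apply add_assoc.
  - intros X Y. now apply (@add_comm _ hdes l m).
  - exists A. intro X.
    assert (hA : f_C O I W A B D A = O).
    { unfold f_C, cross_ratio. rewrite (sub_self hdes h3 hlm h3m hOI A).
      (* The inner product has right factor [O], and its value [O] is in turn the right factor of
         the outer one. *)
      now rewrite !mul_zero. }
    rewrite hA. now apply add_zero.
Qed.
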